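(* For $n\ge3$, let $\mathfrak{g}=\mathfrak{g}_{C_n}$ be the dynamical Lie algebra of QAOA-MaxCut on the $n$-vertex cycle graph. Then $\dim(\mathfrak{g})=3n-1$, and $$\mathcal{B}=\{X,\ X^{n-1},\ ZX^tZ,\ YX^tY,\ YX^tZ:\ t\in\{0,1,\dots,n-2\}\}$$ is a basis of $\mathfrak{g}$.
   Context: Qubits are indexed by $\mathbb{Z}_n=\{0,\dots,n-1\}$ with subscripts modulo $n$; $X_j,Y_j,Z_j$ are the Pauli matrices acting on qubit $j$. $\mathfrak{g}_{C_n}\subseteq\mathfrak{su}(2^n)$ is the real Lie algebra (bracket $[A,B]=AB-BA$) generated by $i\sum_jX_j$ and $i\sum_jZ_jZ_{j+1}$. The following are single symbols (not matrix products): $X=i\sum_{j\in\mathbb{Z}_n}X_j$; $X^{n-1}=i\sum_jX_jX_{j+1}\cdots X_{j+n-2}$; for $0\le t\le n-2$: $ZX^tZ=i\sum_jZ_jX_{j+1}\cdots X_{j+t}Z_{j+t+1}$, $YX^tY=i\sum_jY_jX_{j+1}\cdots X_{j+t}Y_{j+t+1}$, $YX^tZ=i\sum_j(Y_jX_{j+1}\cdots X_{j+t}Z_{j+t+1}+Z_jX_{j+1}\cdots X_{j+t}Y_{j+t+1})$ (for $t=0$ there are no $X$ factors). *)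

(* Defs.v *)
From HB Require Import structures.
From mathcomp Require Import all_boot all_order all_algebra.
From mathcomp.real_closed Require Import complex mxtens.
From mathcomp Require Import reals.

Set Implicit Arguments.
Unset Strict Implicit.
Unset Printing Implicit Defensive.

Import Order.TTheory GRing.Theory Num.Theory.
Local Open Scope ring_scope.
Local Open Scope complex_scope.

(* The alias [cmx R N] carries the real vector-space structure, whereas
   ['M[R[i]]_N] itself is a complex vector space: for [A : cmx R N] and
   [a : R], [a *: A] multiplies every entry by the complex number [a%:C]. *)
Definition cmx (R : realType) (N : nat) : Type := 'M[R[i]]_N.

Section RealStructure.
Variables (R : realType) (N : nat).

HB.instance Definition _ := GRing.Zmodule.copy (cmx R N) 'M[R[i]]_N.

Definition cmx_scale (a : R) (A : cmx R N) : cmx R N :=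
  (a%:C *: (A : 'M[R[i]]_N))%R.

Fact cmx_scaleA a b A : cmx_scale a (cmx_scale b A) = cmx_scale (a * b) A.
Proof. by rewrite /cmx_scale scalerA rmorphM. Qed.
Fact cmx_scale1 : left_id 1 cmx_scale.
Proof. by move=> A; rewrite /cmx_scale rmorph1 scale1r. Qed.
Fact cmx_scaleDr : right_distributive cmx_scale +%R.
Proof. by move=> a A B; rewrite /cmx_scale scalerDr. Qed.
Fact cmx_scaleDl A : {morph cmx_scale^~ A : a b / a + b}.
Proof. by move=> a b; rewrite /cmx_scale rmorphD scalerDl. Qed.

HB.instance Definition _ := GRing.Zmodule_isLmodule.Build R (cmx R N)
  cmx_scaleA cmx_scale1 cmx_scaleDr cmx_scaleDl.

Definition cmx2r (A : cmx R N) : 'rV[R]_(N * N + N * N) :=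
  row_mx (mxvec (map_mx (@complex.Re R) (A : 'M[R[i]]_N)))
         (mxvec (map_mx (@complex.Im R) (A : 'M[R[i]]_N))).
Definition r2cmx (v : 'rV[R]_(N * N + N * N)) : cmx R N :=
  (\matrix_(j, k) (vec_mx (lsubmx v) j k +i* vec_mx (rsubmx v) j k))
    : 'M[R[i]]_N.

Fact cmx_vect_axiom : Vector.axiom (N * N + N * N) (cmx R N).
Proof.
exists cmx2r.
  move=> a A B; rewrite /cmx2r scale_row_mx add_row_mx -!linearP /=.
  by congr (row_mx (mxvec _) (mxvec _)); apply/matrixP=> j k; rewrite !mxE;
     case: (A j k) => ? ?; case: (B j k) => ? ?; rewrite /= !mul0r ?subr0 ?addr0.
exists r2cmx => [A|v].
  apply/matrixP=> j k; rewrite mxE /cmx2r row_mxKl row_mxKr !mxvecK !mxE.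
  by case: (A j k).
rewrite /cmx2r -[RHS]hsubmxK; congr row_mx;
by apply: (can_inj vec_mxK); rewrite mxvecK; apply/matrixP=> j k; rewrite !mxE.
Qed.

HB.instance Definition _ := Lmodule_hasFinDim.Build R (cmx R N) cmx_vect_axiom.

End RealStructure.

Section LieAlgebra.
Variables (R : realType) (N : nat).
Implicit Types (A B : cmx R N) (S : seq (cmx R N)) (V W : {vspace cmx R N}).

Definition lie_bracket A B : cmx R N := A *m B - B *m A.

Definition lie_closed V : Prop :=
  forall A B, A \in V -> B \in V -> lie_bracket A B \in V.

Definition lie_step V : {vspace cmx R N} :=
  (V + <<[seq lie_bracket A B | A <- vbasis V, B <- vbasis V]>>)%VS.

(* [lie_gen S] is the smallest real subspace containing [S] that is closed
   under the bracket; see [lie_gen_sub], [lie_gen_closed] and [lie_gen_min].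
   The increasing chain of subspaces is stationary after at most as many steps
   as the dimension of the ambient space. *)
Definition lie_gen S : {vspace cmx R N} :=
  iter (\dim {:cmx R N}) lie_step <<S>>%VS.

Lemma lie_bracket_sub V W :
  {in vbasis V &, forall A B, lie_bracket A B \in W} ->
  {in V &, forall A B, lie_bracket A B \in W}.
Proof.
move=> VW A B AV BV; rewrite (coord_vbasis AV) (coord_vbasis BV).
have -> : lie_bracket (\sum_i coord (vbasis V) i A *: (vbasis V)`_i)
   (\sum_i coord (vbasis V) i B *: (vbasis V)`_i) =
   \sum_i \sum_j (coord (vbasis V) i A * coord (vbasis V) j B) *:
       lie_bracket (vbasis V)`_i (vbasis V)`_j.
  rewrite /lie_bracket mulmx_suml mulmx_sumr -sumrB; apply: eq_bigr => i _.
  rewrite mulmx_sumr mulmx_suml -sumrB; apply: eq_bigr => j _.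
  rewrite scalerBr.
  have sl (a : R) (C D : cmx R N) :
    (a *: C : cmx R N) *m D = (a *: (C *m D : cmx R N) : cmx R N).
    exact: (esym (scalemxAl _ _ _)).
  have sr (a : R) (C D : cmx R N) :
    C *m (a *: D : cmx R N) = (a *: (C *m D : cmx R N) : cmx R N).
    exact: (esym (scalemxAr _ _ _)).
  rewrite !sl !sr; congr (_ - _); first exact: (@scalerA R (cmx R N)).
  by rewrite [_ * _ : R]mulrC; exact: (@scalerA R (cmx R N)).
apply: memv_suml => i _; apply: memv_suml => j _; apply: memvZ.
by apply: VW; apply: mem_nth; rewrite size_tuple.
Qed.

Lemma lie_step_closed V : (lie_step V <= V)%VS -> lie_closed V.
Proof.
move=> sV A B; apply: lie_bracket_sub A B => A B Ab Bb.
apply: (subvP sV); apply: (subvP (addvSr _ _)); apply: memv_span.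
by apply: allpairs_f.
Qed.

Lemma lie_gen_sub S : {subset S <= lie_gen S}.
Proof.
move=> A AS; rewrite /lie_gen; elim: (\dim _) => [|k IH] /=.
  exact: memv_span.
exact: (subvP (addvSl _ _)).
Qed.

Lemma lie_gen_closed S : lie_closed (lie_gen S).
Proof.
pose V k := iter k lie_step <<S>>%VS.
have VS k : (V k <= V k.+1)%VS by exact: addvSl.
have st k : (V k.+1 <= V k)%VS -> (V k.+2 <= V k.+1)%VS.
  move=> h; have e : V k.+1 = V k by apply/eqP; rewrite eqEsubv h VS.
  by rewrite (congr1 lie_step e : V k.+2 = V k.+1) subvv.
have H k : (V k.+1 <= V k)%VS \/ (k < \dim (V k.+1))%N.
  elim: k => [|k [h|h]]; last 2 first.
  - by left; apply: st.
  - case: (boolP (V k.+2 <= V k.+1)%VS) => h2; [by left|right].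
    apply: leq_ltn_trans h _; rewrite ltn_neqAle dimvS // andbT.
    by apply: contra h2 => /eqP e; rewrite -dimv_leqif_sup // e.
  - case: (boolP (V 1%N <= V 0%N)%VS) => h2; [by left|right].
    rewrite lt0n dimv_eq0; apply: contra h2 => /eqP ->; exact: sub0v.
apply: lie_step_closed; case: (H (\dim {:cmx R N})) => //.
by rewrite ltnNge dimvS // subvf.
Qed.

Lemma lie_gen_min S V :
  {subset S <= V} -> lie_closed V -> (lie_gen S <= V)%VS.
Proof.
move=> SV cV; rewrite /lie_gen; elim: (\dim _) => [|k IH] /=.
  exact/span_subvP.
rewrite subv_add IH; apply/span_subvP => _ /allpairsP[[A B] /= [Ab Bb ->]].
by apply: cV; apply: (subvP IH); apply: vbasis_mem.
Qed.

End LieAlgebra.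

Section Qubits.
Variable R : realType.

Definition pauliX : 'M[R[i]]_2 := \matrix_(a, b) (a != b)%:R.
Definition pauliY : 'M[R[i]]_2 :=
  \matrix_(a, b) (if a == b then 0 else if a == 0 then - 'i%C else 'i%C).
Definition pauliZ : 'M[R[i]]_2 :=
  \matrix_(a, b) (if a == b then (-1) ^+ a else 0).

(* The Kronecker product [P 0 *t P 1 *t ... *t P (n - 1)]. *)
Fixpoint tensor n : ('I_n -> 'M[R[i]]_2) -> 'M[R[i]]_(2 ^ n) :=
  match n with
  | 0 => fun _ => 1%:M
  | m.+1 => fun P =>
      castmx (esym (expnS 2 m), esym (expnS 2 m))
        (P ord0 *t tensor (fun k : 'I_m => P (lift ord0 k)))
  end.

Variable n : nat.
Implicit Types (P Q : 'M[R[i]]_2) (j t : nat).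

(* [P] acting on qubit [j] modulo [n], and the identity on the others. *)
Definition on_qubit P j : 'M[R[i]]_(2 ^ n) :=
  tensor (fun k : 'I_n => if k == j %[mod n] then P else 1%:M).

Local Notation X_ := (on_qubit pauliX).
Local Notation Y_ := (on_qubit pauliY).
Local Notation Z_ := (on_qubit pauliZ).

(* [P_j X_(j+1) ... X_(j+t) Q_(j+t+1)] *)
Definition pauli_string P t Q j : 'M[R[i]]_(2 ^ n) :=
  on_qubit P j *m (\prod_(1 <= k < t.+1) X_ (j + k)) *m on_qubit Q (j + t.+1).

Definition opX : cmx R (2 ^ n) := 'i%C *: \sum_(j < n) X_ j.

(* [X_j X_(j+1) ... X_(j+n-2)] has [n - 1] factors. *)
Definition opXn1 : cmx R (2 ^ n) :=
  'i%C *: \sum_(j < n) \prod_(0 <= k < n.-1) X_ (j + k).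

Definition opZXZ t : cmx R (2 ^ n) :=
  'i%C *: \sum_(j < n) pauli_string pauliZ t pauliZ j.

Definition opYXY t : cmx R (2 ^ n) :=
  'i%C *: \sum_(j < n) pauli_string pauliY t pauliY j.

Definition opYXZ t : cmx R (2 ^ n) :=
  'i%C *: \sum_(j < n)
    (pauli_string pauliY t pauliZ j + pauli_string pauliZ t pauliY j).

Definition dla_cycle : {vspace cmx R (2 ^ n)} :=
  lie_gen [:: opX; 'i%C *: \sum_(j < n) (Z_ j *m Z_ j.+1)].

Definition dla_basis : seq (cmx R (2 ^ n)) :=
  [:: opX; opXn1]
    ++ [seq opZXZ t | t <- iota 0 n.-1]
    ++ [seq opYXY t | t <- iota 0 n.-1]
    ++ [seq opYXZ t | t <- iota 0 n.-1].

End Qubits.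

(* Main.v *)
Require Import Defs.
From mathcomp Require Import all_boot all_order all_algebra.
From mathcomp Require Import zify ring.
From mathcomp.real_closed Require Import complex mxtens.
From mathcomp Require Import reals.

(** Put [e (2j) = -i X_j] and [e (2j+1) = -i Z_j Z_(j+1)], a sequence of period
    [2n] in which [e k] squares to [-1], anticommutes with its two neighbours and
    commutes with all other terms. Every string [Z X^t Z], [Y X^t Y], [Y X^t Z]
    is up to a scalar a product [e a * ... * e (a + l - 1)] of consecutive terms.
    The bracket with [sum_j e (2j)] or [sum_j e (2j+1)] is a derivation for which
    such a product telescopes: only its two ends are lengthened or shortened.
    These are the Onsager relations, in which the period [2n] plays no role; they
    show that the span of the candidate basis is stable under the two generators
    and that every basis element is an iterated bracket of them.
    For independence, the trace against a product matrix depending on a parameter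
    [s] sends the basis elements to multiples of pairwise distinct powers of [s]. *)

Set Implicit Arguments.
Unset Strict Implicit.
Unset Printing Implicit Defensive.

Import Order.TTheory GRing.Theory Num.Theory.
Local Open Scope ring_scope.
Local Open Scope complex_scope.

Lemma big_periodic (T : Type) (idx : T) (op : Monoid.com_law idx)
    (n : nat) (F : nat -> T) (j : nat) :
  (forall k, F (k + n)%N = F k) ->
  \big[op/idx]_(i < n) F (j + i)%N = \big[op/idx]_(i < n) F i.
Proof.
move=> perF; elim: j => [//|j <-]; case: n perF => [|n] perF.
  by rewrite !big_ord0.
rewrite big_ord_recr big_ord_recl /= addn0 Monoid.mulmC addSnnS perF.
by congr (op _ _); apply: eq_bigr => i _; rewrite addSnnS.
Qed.

(** * Cyclic chains of anticommuting elements *)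

Section Chain.
Variables (L : pzRingType) (e : nat -> L).
Hypothesis e_sq : forall k, e k * e k = -1.

Definition comm (x y : L) : L := x * y - y * x.

Lemma commM D x y : comm D (x * y) = comm D x * y + x * comm D y.
Proof. by rewrite /comm mulrBl mulrBr !mulrA subrKA. Qed.

Lemma commB D x y : comm D (x - y) = comm D x - comm D y.
Proof.
rewrite /comm mulrBr mulrBl !opprB addrACA [RHS]addrACA.
by congr (_ + _); exact: addrC.
Qed.

Lemma comm_sumr D n (F : 'I_n -> L) :
  comm D (\sum_i F i) = \sum_i comm D (F i).
Proof. by rewrite /comm mulr_sumr mulr_suml -sumrB. Qed.

Lemma comm_suml n (F : 'I_n -> L) y :
  comm (\sum_i F i) y = \sum_i comm (F i) y.
Proof. by rewrite /comm mulr_sumr mulr_suml -sumrB. Qed.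

Definition seg (a l : nat) : L := \prod_(i < l) e (a + i).

Lemma segS a l : seg a l.+1 = seg a l * e (a + l).
Proof. by rewrite /seg big_ord_recr. Qed.

Lemma segSl a l : seg a l.+1 = e a * seg a.+1 l.
Proof.
rewrite /seg big_ord_recl addn0; congr (_ * _).
by apply: eq_bigr => i _; rewrite /= addSnnS.
Qed.

Lemma seg1 a : seg a 1 = e a.
Proof. by rewrite /seg big_ord1 addn0. Qed.

Section Derivation.
Variables (D : L) (p : bool).
(** In the application [D] is the sum of all [e b] with [odd b = p]. Terms of equal parity commute,
    so of this sum only the neighbours [e a] and [e a.+2] act on [e a.+1], and anticommutation
    doubles each contribution. *)
Hypothesis D_same : forall a, odd a = p -> comm D (e a) = 0.
Hypothesis D_near : forall a, odd a = p ->
  comm D (e a.+1) = (e a * e a.+1 - e a.+1 * e a.+2) *+ 2.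

(* In the Leibniz expansion the terms coming from [e b] and [e b.+2] cancel,
   so only the two ends of the segment contribute. *)
Lemma comm_seg_inner l a : odd a = p ->
  comm D (seg a.+1 l.*2.+1) = (seg a l.*2.+2 - seg a.+1 l.*2.+2) *+ 2.
Proof.
move=> pa; elim: l => [|l IHl].
  by rewrite !segSl /seg !big_ord0 !mulr1 D_near.
rewrite doubleS.
(* The segment grows by the two factors [e b] and [e b.+1]. As [b] has parity [p], the derivation
   kills [e b] and only moves [e b.+1]. *)
set b := (a + l.*2.+2)%N.
have pb : odd b = p by rewrite oddD /= negbK odd_double addbF.
have -> : seg a l.*2.+4 = seg a l.*2.+2 * e b * e b.+1.
  by rewrite segS segS /b !addnS.
have -> : seg a.+1 l.*2.+4 = seg a.+1 l.*2.+1 * e b * e b.+1 * e b.+2.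
  by rewrite 3!segS /b !addSn !addnS.
have -> : seg a.+1 l.*2.+3 = seg a.+1 l.*2.+1 * e b * e b.+1.
  by rewrite 2!segS /b !addSn !addnS.
have Sb : seg a.+1 l.*2.+2 = seg a.+1 l.*2.+1 * e b.
  by rewrite segS /b !addSn !addnS.
rewrite !commM IHl D_same // D_near // mulr0 addr0 Sb.
rewrite mulrnAr !mulrnAl -mulrnDl; congr (_ *+ _).
by rewrite !mulrBl mulrBr !mulrA subrKA.
Qed.

(** The first factor [e a] is killed by [D] and multiplies the result of [comm_seg_inner]. Where
    that result starts with [e a] again, [e a * e a = -1] shortens the segment; otherwise the
    segment gets longer. The next two lemmas treat the right end, and then both ends, in the same
    way. *)
Lemma comm_seg_left l a : odd a = p ->
  comm D (seg a l.*2.+2) = - (seg a.+1 l.*2.+1 + seg a l.*2.+3) *+ 2.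
Proof.
move=> pa; rewrite [seg a l.*2.+2]segSl commM D_same // mul0r add0r.
rewrite comm_seg_inner // mulrnAr; congr (_ *+ _).
by rewrite mulrBr -[e a * seg a.+1 _]segSl segSl mulrA e_sq mulN1r opprD.
Qed.

Lemma comm_seg_right l a : odd a = p ->
  comm D (seg a.+1 l.*2.+2) = (seg a l.*2.+3 + seg a.+1 l.*2.+1) *+ 2.
Proof.
move=> pa; rewrite segS commM D_same ?mulr0 ?addr0; last first.
  by rewrite addSnnS oddD /= odd_double addbF.
rewrite comm_seg_inner // mulrnAl; congr (_ *+ _).
rewrite mulrBl [seg a.+1 _.+2]segS -mulrA e_sq mulrN1 opprK.
by rewrite [seg a _.+3]segS !addnS addSn.
Qed.

Lemma comm_seg_outer l a : odd a = p ->
  comm D (seg a l.*2.+3) = (seg a l.*2.+2 - seg a.+1 l.*2.+2) *+ 2.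
Proof.
move=> pa; rewrite segSl commM D_same // mul0r add0r.
rewrite comm_seg_right // mulrnAr; congr (_ *+ _).
by rewrite mulrDr [seg a _.+3]segSl mulrA e_sq mulN1r -segSl addrC.
Qed.

End Derivation.

Variable n : nat.
Hypothesis e_per : forall k, e (k + n.*2) = e k.

Lemma seg_per a l : seg (a + n.*2) l = seg a l.
Proof. by apply: eq_bigr => i _; rewrite addnAC e_per. Qed.

(** For [p = true] an even start has to be read as the successor of an odd one. This shift rewrites
    the starts [j.*2] as [j.*2 + 2] without changing the sum. *)
Lemma seg_sum_shift a l :
  \sum_(j < n) seg (j.*2 + a.+2) l = \sum_(j < n) seg (j.*2 + a) l.
Proof.
pose F j := seg (j.*2 + a) l.
rewrite -[RHS](@big_periodic _ _ _ _ F 1); last first.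
  by move=> k; rewrite /F doubleD addnAC seg_per.
by apply: eq_bigr => j _; rewrite /F add1n doubleS !addnS.
Qed.

(** Up to sign these become [opZXZ l] for [uu l], [opX] for [ww 0], [opYXY l] for [ww l.+1] and
    [opYXZ l] for [vv l.+1]. The [+ 0] gives both parities the common shape [j.*2 + p]. *)
Definition uu l := \sum_(j < n) seg (j.*2 + 1) l.*2.+1.
Definition ww l := \sum_(j < n) seg (j.*2 + 0) l.*2.+1.
Definition vv l :=
  \sum_(j < n) seg (j.*2 + 0) l.*2 - \sum_(j < n) seg (j.*2 + 1) l.*2.

Hypothesis ww_same : forall a, odd a = false -> comm (ww 0) (e a) = 0.
Hypothesis ww_near : forall a, odd a = false ->
  comm (ww 0) (e a.+1) = (e a * e a.+1 - e a.+1 * e a.+2) *+ 2.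
Hypothesis uu_same : forall a, odd a = true -> comm (uu 0) (e a) = 0.
Hypothesis uu_near : forall a, odd a = true ->
  comm (uu 0) (e a.+1) = (e a * e a.+1 - e a.+1 * e a.+2) *+ 2.

Lemma vv0 : vv 0 = 0.
Proof. by rewrite /vv /seg; under eq_bigr do rewrite big_ord0;
  under [X in _ - X]eq_bigr do rewrite big_ord0; rewrite subrr. Qed.

Let even0 j : odd (j.*2 + 0) = false.
Proof. by rewrite addn0 odd_double. Qed.
Let odd1 j : odd (j.*2 + 1) = true.
Proof. by rewrite addn1 /= odd_double. Qed.

(** The brackets with [ww 0] hold term by term in [j]: the derivation lemmas with [p = false] and
    [a = j.*2] involve only the starts [j.*2] and [j.*2 + 1]. *)
Lemma comm_ww_uu l : comm (ww 0) (uu l) = vv l.+1 *+ 2.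
Proof.
rewrite /uu comm_sumr /vv -sumrB -sumrMnl; apply: eq_bigr => j _.
by rewrite addnS (comm_seg_inner ww_same ww_near) ?even0 // doubleS.
Qed.

Lemma comm_ww_vv l : comm (ww 0) (vv l.+1) = - (uu l + ww l.+1) *+ 4.
Proof.
rewrite /vv -sumrB comm_sumr /uu /ww -big_split /= -sumrN -sumrMnl.
apply: eq_bigr => j _.
rewrite commB doubleS addn1 -{2}[j.*2]addn0 (comm_seg_right ww_same ww_near) //.
rewrite (comm_seg_left ww_same ww_near) // addn0 [seg _ _.+3 + _]addrC.
by rewrite -mulNrn -mulrnDr.
Qed.

Lemma comm_ww_ww l : comm (ww 0) (ww l.+1) = vv l.+1 *+ 2.
Proof.
rewrite {2}/ww comm_sumr /vv -sumrB -sumrMnl; apply: eq_bigr => j _.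
by rewrite doubleS (comm_seg_outer ww_same ww_near) ?even0 // addn1 addn0.
Qed.

Lemma comm_ww_ww0 : comm (ww 0) (ww 0) = 0.
Proof. by rewrite /comm subrr. Qed.

Lemma comm_uu_uu0 : comm (uu 0) (uu 0) = 0.
Proof. by rewrite /comm subrr. Qed.

(** With [p = true] the starts that occur are [j.*2 + 1] and [j.*2 + 2]. After the cyclic shift the
    even segments carry the minus sign, hence [- vv]. *)
Lemma comm_uu_uu l : comm (uu 0) (uu l.+1) = - vv l.+1 *+ 2.
Proof.
rewrite {2}/uu comm_sumr /vv opprB -(seg_sum_shift 0) -sumrB -sumrMnl.
apply: eq_bigr => j _.
by rewrite doubleS (comm_seg_outer uu_same uu_near) ?odd1 // addn1 !addnS addn0.
Qed.

Lemma comm_uu_ww l : comm (uu 0) (ww l) = - vv l.+1 *+ 2.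
Proof.
rewrite /ww -seg_sum_shift comm_sumr /vv opprB.
rewrite -(seg_sum_shift 0) -sumrB -sumrMnl; apply: eq_bigr => j _.
by rewrite [(j.*2 + 2)%N]addnS (comm_seg_inner uu_same uu_near) ?odd1.
Qed.

Lemma comm_uu_vv l : comm (uu 0) (vv l.+1) = (uu l.+1 + ww l) *+ 4.
Proof.
rewrite /vv -(seg_sum_shift 0) -sumrB comm_sumr /uu /ww -(seg_sum_shift 0).
rewrite -big_split /= -sumrMnl; apply: eq_bigr => j _.
rewrite commB [(j.*2 + 2)%N]addnS doubleS (comm_seg_right uu_same uu_near) //.
rewrite (comm_seg_left uu_same uu_near) // -mulNrn opprK.
by rewrite [seg _ _.+3 + _]addrC -mulrnDr.
Qed.

End Chain.

(** * Sums over one parity class act as the required derivations *)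

Section Cyclic.
Variables (L : pzRingType) (e : nat -> L) (n : nat).
Hypothesis n_gt1 : (1 < n)%N.
Hypothesis e_per : forall k, e (k + n.*2) = e k.
Hypothesis e_same : forall a b, odd a = odd b -> comm (e a) (e b) = 0.
Hypothesis e_anti : forall k, e k * e k.+1 = - (e k.+1 * e k).
Hypothesis e_far : forall a i, (1 < i < n)%N -> comm (e (a + i.*2)) (e a.+1) = 0.

(** Periodicity lets the sum start at [a], so that the two neighbours of [e a.+1] become its first
    two terms. *)
Lemma sum_seg1 (p : bool) a : odd a = p ->
  \sum_(j < n) seg e (j.*2 + p) 1 = \sum_(j < n) e (a + j.*2).
Proof.
move=> pa; rewrite -(odd_double_half a) pa.
rewrite -[LHS](@big_periodic _ _ _ _ (fun j => seg e (j.*2 + p) 1) a./2).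
  by apply: eq_bigr => j _; rewrite seg1; congr (e _); lia.
by move=> k; rewrite !seg1 doubleD addnAC e_per.
Qed.

Lemma comm_sum_same (p : bool) a : odd a = p ->
  comm (\sum_(j < n) seg e (j.*2 + p) 1) (e a) = 0.
Proof.
move=> pa; rewrite (sum_seg1 pa) comm_suml big1 // => j _.
by rewrite e_same // oddD odd_double addbF.
Qed.

Lemma comm_sum_near (p : bool) a : odd a = p ->
  comm (\sum_(j < n) seg e (j.*2 + p) 1) (e a.+1) =
  (e a * e a.+1 - e a.+1 * e a.+2) *+ 2.
Proof.
move=> pa; rewrite (sum_seg1 pa) comm_suml.
case: n n_gt1 e_far => [|[|m]] // _ far.
(* Beyond [e a] and [e a.+2] every summand commutes with [e a.+1] by [e_far]. *)
rewrite !big_ord_recl /= big1 => [|i _]; last first.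
  by apply: far; rewrite /bump; have := ltn_ord i; lia.
rewrite addr0 addn0 addn2 mulrnBl; congr (_ + _).
  by rewrite /comm -[e a.+1 * e a]opprK -e_anti opprK mulr2n.
by rewrite /comm e_anti !opprK mulNrn opprK mulr2n.
Qed.

End Cyclic.

(** * Tensor products of Pauli matrices *)

Section Tensor.
Variable R : realType.
Local Notation C := R[i].

Lemma castmx_mulmx (K : pzRingType) (m m' : nat) (eqm : m = m') (A B : 'M[K]_m) :
  castmx (eqm, eqm) A *m castmx (eqm, eqm) B = castmx (eqm, eqm) (A *m B).
Proof. by case: m' / eqm. Qed.

Lemma mxtrace_castmx (K : pzRingType) (m m' : nat) (eqm : m = m') (A : 'M[K]_m) :
  \tr (castmx (eqm, eqm) A) = \tr A.
Proof. by case: m' / eqm. Qed.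

Lemma mxtrace_tens (K : comPzRingType) (m p : nat) (A : 'M[K]_m) (B : 'M[K]_p) :
  \tr (A *t B) = \tr A * \tr B.
Proof. by rewrite /mxtrace mulr_sum; apply: eq_bigr => i _; rewrite mxE. Qed.

Lemma eq_tensor n (P Q : 'I_n -> 'M[C]_2) : P =1 Q -> tensor P = tensor Q.
Proof.
elim: n P Q => [//|n IHn] P Q eqPQ /=; rewrite eqPQ; congr castmx; congr tensmx.
by apply: IHn => k; rewrite eqPQ.
Qed.

Lemma tensorM n (P Q : 'I_n -> 'M[C]_2) :
  tensor P *m tensor Q = tensor (fun k => P k *m Q k).
Proof.
elim: n P Q => [|n IHn] P Q /=; first by rewrite mulmx1.
by rewrite castmx_mulmx tensmx_mul IHn.
Qed.

Lemma tensorZ n (c : 'I_n -> C) (P : 'I_n -> 'M[C]_2) :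
  tensor (fun k => c k *: P k) = (\prod_k c k) *: tensor P.
Proof.
elim: n c P => [|n IHn] c P /=; first by rewrite big_ord0 scale1r.
rewrite IHn big_ord_recl; apply/matrixP => i j.
by rewrite !(mxE, castmxE) mulrACA.
Qed.

Lemma tens1mx1 (K : comPzRingType) (m p : nat) :
  (1%:M : 'M[K]_m) *t (1%:M : 'M[K]_p) = 1%:M.
Proof.
apply/matrixP => i j.
case: (mxtens_indexP i) => i0 i1; case: (mxtens_indexP j) => j0 j1.
by rewrite tensmxE !mxE (can_eq (@mxtens_indexK _ _)) xpair_eqE -natrM mulnb.
Qed.

Lemma tensor1 n : tensor (fun _ : 'I_n => 1%:M) = 1%:M :> 'M[C]_(2 ^ n).
Proof.
elim: n => [//|n IHn] /=; rewrite IHn tens1mx1.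
by apply/matrixP => i j; rewrite castmxE !mxE.
Qed.

Lemma mxtrace_tensor n (P : 'I_n -> 'M[C]_2) :
  \tr (tensor P) = \prod_k \tr (P k).
Proof.
elim: n P => [|n IHn] P /=; first by rewrite big_ord0 mxtrace1.
by rewrite mxtrace_castmx mxtrace_tens IHn big_ord_recl.
Qed.

Lemma pauliXX : pauliX R *m pauliX R = 1%:M.
Proof.
apply/matrixP=> a b; rewrite !mxE !big_ord_recl big_ord0 !mxE.
by case: a => [[|[|//]] ?]; case: b => [[|[|//]] ?];
  rewrite /= ?(mul0r, mulr0, mul1r, add0r, addr0).
Qed.

Lemma pauliZZ : pauliZ R *m pauliZ R = 1%:M.
Proof.
apply/matrixP=> a b; rewrite !mxE !big_ord_recl big_ord0 !mxE.
by case: a => [[|[|//]] ?]; case: b => [[|[|//]] ?];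
  rewrite /= ?(mul0r, mulr0, mul1r, add0r, addr0, expr0, expr1, mulrNN).
Qed.

Lemma pauliXZ : pauliX R *m pauliZ R = - 'i%C *: pauliY R.
Proof.
apply/matrixP=> a b; rewrite !mxE !big_ord_recl big_ord0 !mxE.
by case: a => [[|[|//]] ?]; case: b => [[|[|//]] ?];
  rewrite /= ?(mul0r, mulr0, mul1r, add0r, addr0, expr0, expr1, mulrNN)
    // ?mulNr -expr2 sqr_i ?opprK.
Qed.

Lemma pauliZX : pauliZ R *m pauliX R = 'i%C *: pauliY R.
Proof.
apply/matrixP=> a b; rewrite !mxE !big_ord_recl big_ord0 !mxE.
by case: a => [[|[|//]] ?]; case: b => [[|[|//]] ?];
  rewrite /= ?(mul0r, mulr0, mulr1, add0r, addr0, expr0, expr1, mulrNN)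
    // ?mulrN -expr2 sqr_i ?opprK.
Qed.

Section Qubits.
Variable n : nat.
Hypothesis n_gt0 : (0 < n)%N.
Local Notation on := (@on_qubit R n).
Local Notation X_ := (on (pauliX R)).
Local Notation Y_ := (on (pauliY R)).
Local Notation Z_ := (on (pauliZ R)).
Implicit Types (P Q : 'M[C]_2).

Lemma eq_on_qubit P j k : j = k %[mod n] -> on P j = on P k.
Proof. by move=> jk; apply: eq_tensor => l; rewrite jk. Qed.

Lemma on_qubit_per P j : on P (j + n) = on P j.
Proof. by apply: eq_on_qubit; rewrite modnDr. Qed.

Lemma on_qubitM P Q j : on P j * on Q j = on (P *m Q) j.
Proof.
rewrite -mulmxE tensorM; apply: eq_tensor => k.
by case: ifP => // _; rewrite mulmx1.
Qed.

Lemma on_qubit1 j : on 1%:M j = 1.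
Proof. by rewrite -[RHS]tensor1; apply: eq_tensor => k; rewrite if_same. Qed.

Lemma on_qubitZ c P j : on (c *: P) j = c *: on P j.
Proof.
(* Since [n] is positive, exactly one site is congruent to [j]. The scalar is spread over the sites
   as [c] there and 1 elsewhere. *)
pose k0 := Ordinal (ltn_pmod j n_gt0).
have ek (k : 'I_n) : (k == j %[mod n]) = (k == k0).
  by rewrite -val_eqE /= modn_small.
transitivity (tensor (fun k : 'I_n => (if k == k0 then c else 1) *:
    (if k == j %[mod n] then P else 1%:M))).
  by apply: eq_tensor => k; rewrite ek; case: ifP => // _; rewrite scale1r.
rewrite tensorZ; congr (_ *: _).
by rewrite (bigD1 k0) //= eqxx big1 ?mulr1 // => k /negPf->.
Qed.

Lemma on_qubitC P Q j k : j != k %[mod n] -> on P j * on Q k = on Q k * on P j.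
Proof.
move=> jk; rewrite -!mulmxE !tensorM; apply: eq_tensor => l.
case: eqP => [lj|_]; last by rewrite mul1mx mulmx1.
by rewrite lj (negPf jk) mul1mx mulmx1.
Qed.

Lemma XX j : X_ j * X_ j = 1.
Proof. by rewrite on_qubitM pauliXX on_qubit1. Qed.

Lemma ZZ j : Z_ j * Z_ j = 1.
Proof. by rewrite on_qubitM pauliZZ on_qubit1. Qed.

Lemma XZ j : X_ j * Z_ j = - 'i%C *: Y_ j.
Proof. by rewrite on_qubitM pauliXZ on_qubitZ. Qed.

Lemma ZX j : Z_ j * X_ j = 'i%C *: Y_ j.
Proof. by rewrite on_qubitM pauliZX on_qubitZ. Qed.

Lemma XZ_anti j : X_ j * Z_ j = - (Z_ j * X_ j).
Proof. by rewrite XZ ZX scaleNr. Qed.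

Lemma on_qubit_comm P j k : on P j * on P k = on P k * on P j.
Proof.
by case: (eqVneq (j %% n)%N (k %% n)%N) => [/eq_on_qubit-> //|/on_qubitC->].
Qed.

End Qubits.
End Tensor.

(** * The Ising chain and its segments as Pauli strings *)

Section IsingChain.
Variables (R : realType) (n : nat).
Hypothesis n_gt1 : (1 < n)%N.
Let n_gt0 : (0 < n)%N. Proof. exact: ltnW. Qed.
Local Notation on := (@on_qubit R n).
Local Notation X_ := (on (pauliX R)).
Local Notation Y_ := (on (pauliY R)).
Local Notation Z_ := (on (pauliZ R)).
Local Notation im := ('i%C : R[i]).

Definition ising (k : nat) : 'M[R[i]]_(2 ^ n) :=
  - im *: (if odd k then Z_ k./2 * Z_ k./2.+1 else X_ k./2).

Lemma ising_even j : ising j.*2 = - im *: X_ j.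
Proof. by rewrite /ising odd_double doubleK. Qed.

Lemma ising_odd j : ising j.*2.+1 = - im *: (Z_ j * Z_ j.+1).
Proof. by rewrite /ising /= odd_double uphalf_double. Qed.

Lemma scale_mulmx (c d : R[i]) (A B : 'M[R[i]]_(2 ^ n)) :
  (c *: A) * (d *: B) = (c * d) *: (A * B).
Proof. by rewrite -mulmxE -scalemxAl -scalemxAr scalerA. Qed.

Lemma im_sqr : im * im = -1.
Proof. by rewrite -expr2 sqr_i. Qed.

Lemma parity_half k : (exists j, k = j.*2) \/ (exists j, k = j.*2.+1).
Proof.
rewrite -[k]odd_double_half; case: (odd k); [right|left]; by exists k./2.
Qed.

Lemma bond_sqr j : (Z_ j * Z_ j.+1) * (Z_ j * Z_ j.+1) = 1.
Proof. by rewrite {1}[Z_ j * _]on_qubit_comm -mulrA [X in _ * X]mulrA ZZ mul1r ZZ. Qed.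

Lemma XZ_far j k : j != k %[mod n] -> X_ j * Z_ k = Z_ k * X_ j.
Proof. exact: on_qubitC. Qed.

Lemma succ_neq j : j != j.+1 %[mod n].
Proof. by rewrite -addn1 -{1}[j]addn0 eqn_modDl mod0n modn_small. Qed.

Lemma ising_per k : ising (k + n.*2) = ising k.
Proof.
rewrite /ising oddD odd_double addbF halfD odd_double andbF add0n doubleK.
by rewrite -addSn !on_qubit_per.
Qed.

Lemma ising_sqr k : ising k * ising k = -1.
Proof.
case: (parity_half k) => -[j ->]; rewrite ?ising_even ?ising_odd scale_mulmx
  mulrNN im_sqr ?XX ?bond_sqr scaleN1r //.
Qed.

(** A site term and an adjacent bond share exactly one qubit, because [j] and [j.+1] differ modulo
    [n]. One [Z] of the bond anticommutes with [X] and the other commutes. *)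
Lemma ising_anti k : ising k * ising k.+1 = - (ising k.+1 * ising k).
Proof.
case: (parity_half k) => -[j ->].
  rewrite ising_even ising_odd !scale_mulmx -scalerN; congr (_ *: _).
  rewrite mulrA XZ_anti // mulNr -!mulrA XZ_far //; exact: succ_neq.
rewrite -doubleS ising_even ising_odd !scale_mulmx -scalerN; congr (_ *: _).
rewrite mulrA XZ_far ?[in RHS]eq_sym; last by rewrite eq_sym succ_neq.
by rewrite -mulrA -[in RHS]mulrA XZ_anti // mulrN opprK.
Qed.

Lemma comm_scale (c d : R[i]) (A B : 'M[R[i]]_(2 ^ n)) :
  A * B = B * A -> comm (c *: A) (d *: B) = 0.
Proof. by move=> AB; rewrite /comm !scale_mulmx AB [d * c]mulrC subrr. Qed.

Lemma commute_mul (A B D : 'M[R[i]]_(2 ^ n)) :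
  A * B = B * A -> A * D = D * A -> A * (B * D) = B * D * A.
Proof. by move=> AB AD; rewrite mulrA AB -mulrA AD mulrA. Qed.

Lemma ising_same a b : odd a = odd b -> comm (ising a) (ising b) = 0.
Proof.
rewrite /ising => ->; apply: comm_scale; case: (odd b); last exact: on_qubit_comm.
by apply: commute_mul; apply/esym/commute_mul; exact: on_qubit_comm.
Qed.

(** One of the two terms is a site and the other a bond; [1 < i < n] keeps the site away from both
    ends of the bond modulo [n]. *)
Lemma ising_far a i : (1 < i < n)%N -> comm (ising (a + i.*2)) (ising a.+1) = 0.
Proof.
case/andP=> i_gt1 i_ltn.
have neq0 j : j + i != j %[mod n].
  by rewrite -{2}[j]addn0 eqn_modDl mod0n modn_small //; lia.
have neq1 j : j + i != j.+1 %[mod n].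
  by rewrite -[j.+1]addn1 eqn_modDl !modn_small //; lia.
case: (parity_half a) => -[j ->].
  rewrite -doubleD ising_even ising_odd; apply: comm_scale.
  by apply: commute_mul; apply: XZ_far.
rewrite -doubleS addSn -doubleD ising_even ising_odd; apply: comm_scale.
apply/esym/commute_mul; apply: XZ_far; rewrite eq_sym //.
by rewrite -addn1 -[j.+1]addn1 eqn_modDr.
Qed.

Local Notation segI := (seg ising).
Local Notation str P t Q j := (@pauli_string R n P t Q j).

Lemma pauli_stringE P t Q j :
  str P t Q j = on P j * (\prod_(1 <= k < t.+1) X_ (j + k)) * on Q (j + t.+1).
Proof. by []. Qed.

(** Two further factors append [X_k] and the bond [Z_k Z_(k+1)] to a string ending in [Z_k]. As
    [Z X Z = - X], the end moves one site on and leaves an [X] behind; the new scalar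
    [(- im) * (- im) = -1] cancels the sign. *)
Lemma seg_ZXZ t j :
  segI (j.*2 + 1) t.*2.+1 = - im *: str (pauliZ R) t (pauliZ R) j.
Proof.
elim: t => [|t IHt].
  rewrite seg1 addn1 ising_odd pauli_stringE big_geq; last by [].
  by rewrite mulr1 addn1.
rewrite doubleS 2!segS IHt.
have -> : (j.*2 + 1 + t.*2.+1 = (j + t.+1).*2)%N by lia.
have -> : (j.*2 + 1 + t.*2.+2 = (j + t.+1).*2.+1)%N by lia.
rewrite ising_even ising_odd !scale_mulmx mulrNN im_sqr mulN1r opprK.
have ZXZ k A : Z_ k * (X_ k * (Z_ k * A)) = - (X_ k * A).
  by rewrite !mulrA -[Z_ k * X_ k]opprK -XZ_anti // !mulNr -[X_ k * _ * _]mulrA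
    ZZ mulr1.
rewrite !pauli_stringE [in RHS]big_nat_recr; last by [].
rewrite -!mulrA ZXZ !addnS; apply/esym.
by rewrite !mulrN scaleNr scalerN.
Qed.

(** A site term at each end turns the end factors into [Y], through [X Z = - i Y] on the left and
    [Z X = i Y] on the right. *)
Lemma seg_YXY t j :
  segI (j.*2 + 0) t.*2.+3 = im *: str (pauliY R) t (pauliY R) j.
Proof.
rewrite segSl segS addn0 -[j.*2.+1]addn1 seg_ZXZ.
have -> : (j.*2 + 1 + t.*2.+1 = (j + t.+1).*2)%N by lia.
rewrite !ising_even !scale_mulmx !pauli_stringE !mulrA (XZ _ n_gt0) -!mulrA (ZX _ n_gt0).
rewrite -!mulmxE -!scalemxAr -!scalemxAl !scalerA !mulmxE.
congr (_ *: _).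
by ring: im_sqr.
Qed.

Lemma seg_YXZ t j :
  segI (j.*2 + 0) t.*2.+2 = im *: str (pauliY R) t (pauliZ R) j.
Proof.
rewrite segSl addn0 -[j.*2.+1]addn1 seg_ZXZ.
rewrite !ising_even !scale_mulmx !pauli_stringE !mulrA (XZ _ n_gt0).
rewrite -!mulmxE -!scalemxAl !scalerA mulrNN im_sqr mulN1r opprK.
by [].
Qed.

(** The sign is opposite to that of [seg_YXZ], as [X Z] and [Z X] differ by a sign. This is why the
    difference [vv] yields the symmetric sum in [opYXZ]. *)
Lemma seg_ZXY t j :
  segI (j.*2 + 1) t.*2.+2 = - im *: str (pauliZ R) t (pauliY R) j.
Proof.
rewrite segS seg_ZXZ.
have -> : (j.*2 + 1 + t.*2.+1 = (j + t.+1).*2)%N by lia.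
rewrite !ising_even !scale_mulmx !pauli_stringE -!mulrA (ZX _ n_gt0).
rewrite -!mulmxE -!scalemxAr !scalerA mulrNN im_sqr mulN1r.
by [].
Qed.

Local Notation U := (uu ising n).
Local Notation V := (vv ising n).
Local Notation W := (ww ising n).

Lemma opXE : opX R n = - W 0 :> 'M_(2 ^ n).
Proof.
rewrite /opX /ww scaler_sumr -sumrN; apply: eq_bigr => j _.
by rewrite seg1 addn0 ising_even scaleNr opprK.
Qed.

Lemma opZXZE t : opZXZ R n t = - U t :> 'M_(2 ^ n).
Proof.
rewrite /opZXZ /uu scaler_sumr -sumrN; apply: eq_bigr => j _.
by rewrite seg_ZXZ scaleNr opprK.
Qed.

Lemma opYXYE t : opYXY R n t = W t.+1 :> 'M_(2 ^ n).
Proof.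
rewrite /opYXY /ww scaler_sumr; apply: eq_bigr => j _.
by rewrite doubleS seg_YXY.
Qed.

Lemma opYXZE t : opYXZ R n t = V t.+1 :> 'M_(2 ^ n).
Proof.
rewrite /opYXZ /vv -sumrB scaler_sumr; apply: eq_bigr => j _.
rewrite doubleS seg_YXZ seg_ZXY.
by rewrite scalerDr scaleNr opprK.
Qed.

Lemma generator_ZZE :
  im *: (\sum_(j < n) (Z_ j *m Z_ j.+1)) = - U 0 :> 'M_(2 ^ n).
Proof.
rewrite /uu scaler_sumr -sumrN; apply: eq_bigr => j _.
by rewrite seg1 addn1 ising_odd scaleNr opprK.
Qed.

(* At [t = n - 1] both [Z] factors of the string sit on the same qubit. *)
Lemma opXn1E : opXn1 R n = - U n.-1 :> 'M_(2 ^ n).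
Proof.
rewrite -opZXZE /opXn1 /opZXZ; congr (_ *: _).
pose F j := \prod_(0 <= k < n.-1) X_ (j + k).
(* The run of [X] factors starts at [j] in [opXn1] but at [j + 1] in the string; a cyclic shift of
   the sum aligns them. *)
rewrite -(@big_periodic _ _ _ _ F 1); last first.
  by move=> k; apply: eq_bigr => i _; rewrite addnAC on_qubit_per.
apply: eq_bigr => j _; rewrite pauli_stringE prednK // on_qubit_per.
have -> : F (1 + j)%N = \prod_(1 <= k < n) X_ (j + k).
  rewrite big_add1 /F.
  by apply: eq_bigr => k _; congr (on _ _); lia.
set A := \prod_(1 <= k < n) _.
suff ZA : Z_ j * A = A * Z_ j by rewrite ZA -mulrA ZZ mulr1.
rewrite /A {A} big_nat_cond.
apply: (big_ind (fun A => Z_ j * A = A * Z_ j)) => [|A B ZA ZB|k].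
- by rewrite mul1r mulr1.
- by rewrite -mulrA -ZB !mulrA ZA.
rewrite andbT => /andP[k_gt0 k_ltn]; apply/esym/XZ_far.
by rewrite -{2}[j : nat]addn0 eqn_modDl mod0n modn_small // -lt0n.
Qed.

End IsingChain.

(** * Linear independence *)

Section Independence.
Variable R : realType.

Lemma horner0_eq0 (p : {poly R}) : (forall s, p.[s] = 0) -> p = 0.
Proof.
move=> p0; apply/eqP; apply: contraT => nz_p.
(* The naturals below [size p] are distinct in [R] and give one root more than a nonzero [p] can
   have. *)
pose rs := [seq i%:R : R | i <- iota 0 (size p)].
suff: (size rs < size p)%N by rewrite size_map size_iota ltnn.
apply: max_poly_roots => //; first by apply/allP => s _; rewrite /root p0.
by rewrite map_inj_uniq ?iota_uniq // => i j /eqP; rewrite eqr_nat => /eqP.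
Qed.

(** An entry of [L] is a vector, an exponent and a coefficient. Applying every [phi s] to a
    vanishing combination gives a polynomial in [s] with no nonzero value. As the exponents are
    distinct, its coefficient at the exponent of entry [j] is [k j] times a nonzero constant. *)
Lemma free_monomials (V : vectType R) (phi : R -> V -> R) (L : seq (V * nat * R)) :
  (forall s a u v, phi s (a *: u + v) = a * phi s u + phi s v) ->
  uniq [seq p.1.2 | p <- L] ->
  (forall p, p \in L -> p.2 != 0) ->
  (forall p s, p \in L -> phi s p.1.1 = p.2 * s ^+ p.1.2) ->
  free [seq p.1.1 | p <- L].
Proof.
move=> phi_lin uniq_w c_neq0 phiE; set X := map _ L.
have phi0 s : phi s 0 = 0.
  by have := phi_lin s (-1) 0 0; rewrite scaleN1r oppr0 addr0 mulN1r addNr.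
have sizeX : size X = size L by rewrite size_map.
apply/(@freeP _ _ _ (in_tuple X)) => k sum0 j; rewrite /= in k j sum0 *.
pose p0 : V * nat * R := (0, 0%N, 0).
have inL (i : 'I_(size X)) : nth p0 L i \in L by rewrite mem_nth -?sizeX.
have nthX (i : 'I_(size X)) : X`_i = (nth p0 L i).1.1.
  by rewrite (nth_map p0) -?sizeX.
pose q : {poly R} := \sum_i (k i * (nth p0 L i).2) *: 'X^((nth p0 L i).1.2).
have q0 : q = 0.
  apply: horner0_eq0 => s; rewrite horner_sum.
  transitivity (phi s (\sum_(i < size X) k i *: X`_i)); last by rewrite sum0.
  apply: (big_ind2 (fun u v => u = phi s v)) => [|u v u' v' -> ->|i _].
  - by rewrite phi0.
  - by rewrite -[v]scale1r phi_lin mul1r scale1r.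
  - rewrite nthX -[_ *: _ : V]addr0 phi_lin phi0 addr0 (phiE _ _ (inL i)).
    by rewrite hornerZ hornerXn mulrA.
have := congr1 (fun r : {poly R} => r`_(nth p0 L j).1.2) q0.
rewrite coef0 coef_sum (bigD1 j) //= big1 => [|i ij].
  rewrite addr0 coefZ coefXn eqxx mulr1 => /eqP.
  by rewrite mulf_eq0 (negPf (c_neq0 _ (inL j))) orbF => /eqP.
rewrite coefZ coefXn; case: eqP => [wij|_]; last by rewrite mulr0.
have nth_w (l : 'I_(size X)) : nth 0%N [seq p.1.2 | p <- L] l = (nth p0 L l).1.2.
  by rewrite (nth_map p0) -?sizeX.
have lt_w (l : 'I_(size X)) : (l < size [seq p.1.2 | p <- L])%N.
  by rewrite size_map -sizeX.
have := nth_uniq 0%N (lt_w i) (lt_w j) uniq_w.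
by rewrite !nth_w wij eqxx val_eqE (negPf ij).
Qed.

Lemma prod_prefix (K : comPzRingType) (n b : nat) (x : K) (f : nat -> K) :
  (b <= n)%N -> (forall d, (d < b)%N -> f d = x) ->
  (forall d, (b <= d)%N -> f d = 1) -> \prod_(d < n) f d = x ^+ b.
Proof.
move=> bn fx f1; rewrite -(big_mkord xpredT f).
rewrite (@big_cat_nat _ _ _ b) /=; [|by []|exact: bn].
rewrite (eq_big_nat _ _ (F2 := fun=> x)) => [|d /andP[_ /fx]//].
rewrite prodr_const_nat subn0 big_nat_cond big1 ?mulr1 // => d.
by rewrite andbT => /andP[/f1].
Qed.

Lemma prod_string (K : comPzRingType) (n t : nat) (a x b : K) (f : nat -> K) :
  (t.+1 < n)%N -> f 0%N = a -> (forall d, (0 < d <= t)%N -> f d = x) ->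
  f t.+1 = b -> (forall d, (t.+1 < d)%N -> f d = 1) ->
  \prod_(d < n) f d = a * x ^+ t * b.
Proof.
case: n => // n tn fa fx fb f1; rewrite big_ord_recl fa -mulrA; congr (_ * _).
rewrite -(big_mkord xpredT (fun d => f d.+1)).
rewrite (@big_cat_nat _ _ _ t) /=; [|by []|exact: ltnW].
congr (_ * _).
  rewrite (eq_big_nat _ _ (F2 := fun=> x)) => [|d /andP[_ dt]]; last exact: fx.
  by rewrite prodr_const_nat subn0.
rewrite big_ltn; last exact: tn.
rewrite fb big_nat_cond big1 ?mulr1 // => d.
by rewrite andbT => /andP[td _]; rewrite f1.
Qed.

(** * Product functionals evaluated on Pauli strings *)

Section Weights.
Variables (n : nat).
Hypothesis n_gt0 : (0 < n)%N.
Local Notation C := R[i].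
Local Notation on := (@on_qubit R n).
Local Notation X_ := (on (pauliX R)).
Local Notation str P t Q j := (@pauli_string R n P t Q j).

(** The argument of [F] is the offset of site [k] from [j] modulo [n]; writing [n - j %% n] avoids
    truncated subtraction. *)
Definition cyclic_tensor (j : nat) (F : nat -> 'M[C]_2) : 'M[C]_(2 ^ n) :=
  tensor (fun k : 'I_n => F ((n - j %% n + k) %% n)%N).

Lemma cyclic_tensorM j F G :
  cyclic_tensor j F * cyclic_tensor j G = cyclic_tensor j (fun d => F d *m G d).
Proof. by rewrite -mulmxE tensorM. Qed.

Lemma eq_cyclic_tensor j F G : F =1 G -> cyclic_tensor j F = cyclic_tensor j G.
Proof. by move=> FG; apply: eq_tensor => k. Qed.

Lemma on_qubit_cyclic P j m : (m < n)%N ->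
  on P (j + m) = cyclic_tensor j (fun d => if d == m then P else 1%:M).
Proof.
move=> m_ltn; apply: eq_tensor => k; congr (if _ then _ else _).
have jn := ltn_pmod j n_gt0.
rewrite -[X in _ = (_ == X)](modn_small m_ltn) -[in RHS](eqn_modDr (j %% n)%N).
have -> : (n - j %% n + k + j %% n = k + n)%N by lia.
by rewrite modnDr modnDmr [(m + j)%N]addnC.
Qed.

Lemma prod_X_cyclic j a b : (a <= b <= n)%N ->
  \prod_(a <= k < b) X_ (j + k) =
  cyclic_tensor j (fun d => if (a <= d < b)%N then pauliX R else 1%:M).
Proof.
elim: b => [|b IHb] /andP[ab b_ltn].
  rewrite big_geq // -[LHS]tensor1; apply: eq_tensor => k.
  by rewrite ltn0 andbF.
move: ab; rewrite leq_eqVlt => /predU1P[->|ab].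
  rewrite big_geq // -[LHS]tensor1; apply: eq_tensor => k.
  by case: ifP => // /andP[]; lia.
rewrite big_nat_recr; last by [].
rewrite [LHS]/=.
have abn : (a <= b <= n)%N by rewrite (ltnW b_ltn) andbT.
rewrite (IHb abn) (on_qubit_cyclic _ _ b_ltn) cyclic_tensorM.
apply: eq_cyclic_tensor => d; rewrite ltnS; case: (ltngtP d b) => [db|db|->].
- by rewrite mulmx1.
- by rewrite !andbF mulmx1.
by rewrite andbF -ltnS ab mul1mx.
Qed.

(** For [t.+1 < n] the offsets from 0 to [t.+1] are distinct modulo [n], so each site carries at
    most one factor of the string. *)
Lemma pauli_string_cyclic P t Q j : (t.+1 < n)%N ->
  str P t Q j = cyclic_tensor j (fun d => if d == 0%N then P else
    if (d <= t)%N then pauliX R else if d == t.+1 then Q else 1%:M).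
Proof.
move=> t_ltn; rewrite pauli_stringE -{1}[j]addn0.
rewrite (on_qubit_cyclic _ _ n_gt0) (on_qubit_cyclic _ _ t_ltn).
have t1n : (1 <= t.+1 <= n)%N by exact: ltnW.
rewrite (prod_X_cyclic _ t1n) !cyclic_tensorM; apply: eq_cyclic_tensor => d.
case: d => [|d]; first by rewrite !mulmx1.
rewrite mul1mx /= ltnS; case: ifP => dt; last by rewrite mul1mx.
by rewrite ifF ?mulmx1 //; lia.
Qed.

Section Functional.
Variables x y z : C.

(* Its trace pairing with [1], [X], [Y], [Z] is [1], [x], [y], [z]. *)
Definition pauli_weight : 'M[C]_2 :=
  2^-1 *: (1%:M + x *: pauliX R + y *: pauliY R + z *: pauliZ R).

Definition total_weight (A : 'M[C]_(2 ^ n)) : C :=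
  \tr (tensor (fun _ => pauli_weight) *m A).

Let half2 : 2 * 2^-1 = 1 :> C. Proof. by rewrite mulfV // pnatr_eq0. Qed.
Let ii : 'i%C * 'i%C = -1 :> C. Proof. by rewrite -expr2 sqr_i. Qed.

Lemma pauli_weight1 : \tr (pauli_weight *m 1%:M) = 1.
Proof.
rewrite mulmx1 /mxtrace !big_ord_recl big_ord0 !mxE /= expr0 expr1.
by ring: half2.
Qed.

Lemma pauli_weightX : \tr (pauli_weight *m pauliX R) = x.
Proof.
rewrite /mxtrace !big_ord_recl big_ord0 !mxE !big_ord_recl !big_ord0 !mxE /=.
rewrite expr0 expr1; by ring: half2.
Qed.

Lemma pauli_weightY : \tr (pauli_weight *m pauliY R) = y.
Proof.
rewrite /mxtrace !big_ord_recl big_ord0 !mxE !big_ord_recl !big_ord0 !mxE /=.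
rewrite expr0 expr1; by ring: half2 ii.
Qed.

Lemma pauli_weightZ : \tr (pauli_weight *m pauliZ R) = z.
Proof.
rewrite /mxtrace !big_ord_recl big_ord0 !mxE !big_ord_recl !big_ord0 !mxE /=.
rewrite expr0 expr1; by ring: half2 ii.
Qed.

(** The trace of a tensor product is the product of the traces, and rotating the sites permutes
    these factors. Hence all translates of a string have the same weight. *)
Lemma total_weight_cyclic j F :
  total_weight (cyclic_tensor j F) = \prod_(d < n) \tr (pauli_weight *m F d).
Proof.
rewrite /total_weight tensorM mxtrace_tensor.
pose G d := \tr (pauli_weight *m F (d %% n)%N).
transitivity (\prod_(d < n) G d); last first.
  by apply: eq_bigr => d _; rewrite /G modn_small.
rewrite -(@big_periodic _ _ _ _ G (n - j %% n)%N) // => k.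
by rewrite /G modnDr.
Qed.

Lemma total_weight_string P t Q j : (t.+1 < n)%N ->
  total_weight (str P t Q j) =
  \tr (pauli_weight *m P) * x ^+ t * \tr (pauli_weight *m Q).
Proof.
move=> t_ltn; rewrite (pauli_string_cyclic _ _ _ t_ltn) total_weight_cyclic.
pose f d := if d == 0%N then P else
  if (d <= t)%N then pauliX R else if d == t.+1 then Q else 1%:M.
apply: (@prod_string _ n t _ x _ (fun d => \tr (pauli_weight *m f d))) => //.
- by case=> // d /andP[_ dt]; rewrite /f [_ == _]/= dt pauli_weightX.
- by rewrite /f [_ == _]/= ltnn eqxx.
by move=> d td; rewrite /f !ifF ?pauli_weight1 //; lia.
Qed.

Lemma total_weight_prod_X b j : (b <= n)%N ->
  total_weight (\prod_(0 <= k < b) X_ (j + k)) = x ^+ b.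
Proof.
move=> bn; rewrite (prod_X_cyclic _ (a := 0)) // total_weight_cyclic.
pose f d := if (d < b)%N then pauliX R else 1%:M.
apply: (@prod_prefix _ n b x (fun d => \tr (pauli_weight *m f d))) => // d db.
  by rewrite /f db pauli_weightX.
by rewrite /f [X in if X then _ else _]ltnNge db pauli_weight1.
Qed.

End Functional.

(* The weights [s], [s ^+ (3 * n)], [s ^+ n] of [X], [Y], [Z] are chosen so that
   the exponents attached to the basis elements are pairwise distinct. *)
Definition basis_weight (s : R) (A : cmx R (2 ^ n)) : R :=
  complex.Im (total_weight s%:C (s ^+ (3 * n))%:C (s ^+ n)%:C A).

Lemma total_weight_sum x y z (f : 'I_n -> 'M[C]_(2 ^ n)) :
  total_weight x y z (\sum_j f j) = \sum_j total_weight x y z (f j).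
Proof. by rewrite /total_weight mulmx_sumr raddf_sum. Qed.

Lemma total_weightD x y z A B :
  total_weight x y z (A + B) = total_weight x y z A + total_weight x y z B.
Proof. by rewrite /total_weight mulmxDr mxtraceD. Qed.

Lemma total_weightZ x y z c A :
  total_weight x y z (c *: A) = c * total_weight x y z A.
Proof. by rewrite /total_weight -scalemxAr mxtraceZ. Qed.

Lemma basis_weight_linear s a u v :
  basis_weight s (a *: u + v) = a * basis_weight s u + basis_weight s v.
Proof.
rewrite /basis_weight total_weightD total_weightZ.
case: (total_weight _ _ _ u) => p q; case: (total_weight _ _ _ v) => p' q'.
by rewrite /= mul0r addr0.
Qed.

(** The factor [i] puts the real weights into the imaginary part. The multiplicity [k] counts the
    strings per site: 2 for [opYXZ] and 1 otherwise. *)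
Lemma basis_weight_isum s (f : 'I_n -> 'M[C]_(2 ^ n)) (m k : nat) :
  (forall j, total_weight s%:C (s ^+ (3 * n))%:C (s ^+ n)%:C (f j) =
             (s ^+ m)%:C *+ k) ->
  basis_weight s ('i%C *: \sum_j f j) = (k * n)%:R * s ^+ m.
Proof.
move=> fE; rewrite /basis_weight total_weightZ total_weight_sum.
rewrite (eq_bigr _ (fun j _ => fE j)) sumr_const card_ord -mulrnA -rmorphMn /=.
by rewrite mul0r mul1r add0r mulr_natl.
Qed.

End Weights.

(** Each [Z] contributes [n] to the exponent, each [Y] contributes [3 * n] and each [X] contributes
    1. With [t < n.-1] the ranges starting at [2 * n], [4 * n] and [6 * n] are disjoint and lie
    above 1 and [n.-1], which differ because [2 < n]. *)
Lemma free_dla_basis n : (2 < n)%N -> free (dla_basis R n).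
Proof.
move=> n_gt2; have n_gt0 : (0 < n)%N by lia.
pose T := iota 0 n.-1.
pose L : seq (cmx R (2 ^ n) * nat * R) :=
  [:: (opX R n, 1%N, n%:R); (opXn1 R n, n.-1, n%:R)]
  ++ [seq (opZXZ R n t, (2 * n + t)%N, n%:R) | t <- T]
  ++ [seq (opYXY R n t, (6 * n + t)%N, n%:R) | t <- T]
  ++ [seq (opYXZ R n t, (4 * n + t)%N, (2 * n)%:R) | t <- T].
have -> : dla_basis R n = [seq p.1.1 | p <- L].
  by rewrite /L !map_cat -!map_comp.
have LP (Q : cmx R (2 ^ n) * nat * R -> Prop) :
  Q (opX R n, 1%N, n%:R) -> Q (opXn1 R n, n.-1, n%:R) ->
  (forall t, (t.+1 < n)%N -> Q (opZXZ R n t, (2 * n + t)%N, n%:R)) ->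
  (forall t, (t.+1 < n)%N -> Q (opYXY R n t, (6 * n + t)%N, n%:R)) ->
  (forall t, (t.+1 < n)%N -> Q (opYXZ R n t, (4 * n + t)%N, (2 * n)%:R)) ->
  forall p, p \in L -> Q p.
  move=> Q1 Q2 Q3 Q4 Q5 p; rewrite /L !mem_cat !inE.
  have inT t : t \in T -> (t.+1 < n)%N by rewrite mem_iota; lia.
  by case/orP=> [/orP[]/eqP->//|/or3P[]/mapP[t /inT tn ->]]; auto.
apply: (@free_monomials _ (@basis_weight n)).
- exact: basis_weight_linear.
- rewrite /L !map_cat -!map_comp.
  have uT (m : nat) : uniq [seq (m * n + t)%N | t <- T].
    by rewrite map_inj_uniq ?iota_uniq // => a b; lia.
  rewrite !cat_uniq !uT /= !andbT inE; apply/and3P; split; first by lia.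
    apply/hasPn => w; rewrite !mem_cat !inE => /or3P[]/mapP[t _ ->] /=; lia.
  apply/andP; split; apply/hasPn => w; rewrite ?mem_cat.
    case/orP=> /mapP[t + ->]; rewrite mem_iota /= => tn;
    by apply/mapP => -[t' + /=]; rewrite mem_iota; lia.
  move=> /mapP[t + ->]; rewrite mem_iota /= => tn.
  by apply/mapP => -[t' + /=]; rewrite mem_iota; lia.
- by apply: LP => [||t _|t _|t _] /=; rewrite pnatr_eq0; lia.
move=> p s; move: p; apply: LP => [||t tn|t tn|t tn] /=.
- rewrite -[in RHS](mul1n n); apply: basis_weight_isum => j; rewrite mulr1n.
  (* A single [X] is treated as a run of length one. *)
  have -> : on_qubit n (pauliX R) j =
      \prod_(0 <= k < 1) on_qubit n (pauliX R) (j + k) :> 'M_(2 ^ n).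
    by rewrite big_nat1 addn0.
  by rewrite total_weight_prod_X.
- rewrite -[in RHS](mul1n n); apply: basis_weight_isum => j; rewrite mulr1n.
  rewrite total_weight_prod_X; [|by []|exact: leq_pred].
  by rewrite mul1n rmorphXn.
- rewrite -[in X in X%:R](mul1n n); apply: basis_weight_isum => j; rewrite mulr1n.
  rewrite total_weight_string // pauli_weightZ -rmorphXn -!rmorphM -!exprD.
  by congr (_ ^+ _)%:C; lia.
- rewrite -[in X in X%:R](mul1n n); apply: basis_weight_isum => j; rewrite mulr1n.
  rewrite total_weight_string // pauli_weightY -rmorphXn -!rmorphM -!exprD.
  by congr (_ ^+ _)%:C; lia.
apply: basis_weight_isum => j; rewrite mulr2n.
rewrite total_weightD !total_weight_string // pauli_weightY pauli_weightZ.
rewrite -rmorphXn -!rmorphM -!exprD.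
by congr ((_ ^+ _)%:C + (_ ^+ _)%:C); lia.
Qed.

End Independence.

(** * Generation *)

Section LieSpan.
Variables (R : realType) (N : nat).
Implicit Types (A B D : cmx R N) (S X : seq (cmx R N)) (V W : {vspace cmx R N}).

Lemma span_ind (K : fieldType) (vT : vectType K) (X : seq vT) (Q : vT -> Prop) :
  Q 0 -> (forall a u v, Q u -> Q v -> Q (a *: u + v)) ->
  (forall u, u \in X -> Q u) -> forall v, v \in <<X>>%VS -> Q v.
Proof.
move=> Q0 QD QX v vX; rewrite (@coord_span _ _ _ (in_tuple X) _ vX).
elim/big_rec: _ => [//|i u _ Qu]; apply: QD Qu; apply: QX.
exact: mem_nth.
Qed.

Lemma lie_bracketDl a A B D :
  lie_bracket (a *: A + B) D = a *: lie_bracket A D + lie_bracket B D.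
Proof.
rewrite /lie_bracket mulmxDl mulmxDr scalerBr opprD addrACA.
by congr (_ - _ + _); [exact/esym/scalemxAl|exact/esym/scalemxAr].
Qed.

Lemma lie_bracketC A B : lie_bracket A B = - lie_bracket B A.
Proof. by rewrite /lie_bracket opprB. Qed.

Lemma lie_bracketDr a A B D :
  lie_bracket D (a *: A + B) = a *: lie_bracket D A + lie_bracket D B.
Proof.
by rewrite lie_bracketC lie_bracketDl opprD -scalerN -!lie_bracketC.
Qed.

(** This is the Leibniz rule for [comm A] applied to [B * D - D * B], regrouped. *)
Lemma lie_bracket_jacobi A B D :
  lie_bracket (lie_bracket A B) D =
  lie_bracket A (lie_bracket B D) - lie_bracket B (lie_bracket A D).
Proof.
apply/eqP; rewrite eq_sym subr_eq; apply/eqP.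
have := commB A (B * D : 'M_N) (D * B).
rewrite !commM => E; apply: (etrans E).
by rewrite [X in _ - X]addrC opprD addrACA.
Qed.

Lemma lie_bracket0 A : lie_bracket 0 A = 0.
Proof. by rewrite /lie_bracket mul0mx mulmx0 subrr. Qed.

Lemma lie_bracket_r0 A : lie_bracket A 0 = 0.
Proof. by rewrite lie_bracketC lie_bracket0 oppr0. Qed.

(* By the Jacobi identity the elements of [W] whose bracket preserves [W] form
   a Lie algebra, so stability of [W] only has to be tested on generators. *)
Lemma lie_gen_stable S W :
  {subset S <= W} ->
  (forall A B, A \in S -> B \in W -> lie_bracket A B \in W) ->
  (lie_gen S <= W)%VS.
Proof.
move=> SW stabS.
have spanP X : {subset X <= W} ->
    (forall A B, A \in X -> B \in W -> lie_bracket A B \in W) ->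
    forall A B, A \in <<X>>%VS -> B \in W -> lie_bracket A B \in W.
  move=> XW stab A B AX BW.
  move: AX; apply: (span_ind (Q := fun A => lie_bracket A B \in W)).
  - by rewrite lie_bracket0 mem0v.
  - by move=> a C D CW DW; rewrite lie_bracketDl memvD ?memvZ.
  - by move=> C CX; apply: stab.
(* Containment and stability are carried together along the iteration: stability puts the new
   brackets into [W], and the Jacobi identity makes them preserve [W]. *)
suff [] : (lie_gen S <= W)%VS /\
    (forall A B, A \in lie_gen S -> B \in W -> lie_bracket A B \in W) by [].
rewrite /lie_gen; elim: (\dim _) => [|k [kW stab]] /=.
  by split; [apply/span_subvP|apply: spanP].
set V := iter k _ _ in kW stab *.
have brW : {subset [seq lie_bracket A B | A <- vbasis V, B <- vbasis V] <= W}.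
  move=> _ /allpairsP[[A B] /= [/vbasis_mem AV /vbasis_mem BV ->]].
  by apply: stab => //; apply: (subvP kW).
split; first by rewrite subv_add kW; apply/span_subvP.
move=> A D /memv_addP[B BV [C CV ->]] DW.
rewrite -[B]scale1r lie_bracketDl scale1r.
apply: memvD; first exact: stab.
apply: (spanP _ brW _ _ _ CV DW) => A' G.
move=> /allpairsP[[E F] /= [/vbasis_mem EV /vbasis_mem FV ->]] GW.
by rewrite lie_bracket_jacobi memvB ?stab.
Qed.

(** Used to divide out the factors 2 and 4 of the bracket relations. *)
Lemma memv_mulrn V A k : A *+ k.+1 \in V -> A \in V.
Proof.
by rewrite -scaler_nat => /(memvZ k.+1%:R^-1); rewrite scalerK // pnatr_eq0.
Qed.

End LieSpan.

(** * Bracket relations on the cycle and the two inclusions *)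

Section Main.
Variables (R : realType) (n : nat).
Hypothesis n_gt2 : (2 < n)%N.
Let n_gt1 : (1 < n)%N. Proof. exact: ltnW. Qed.
Let n_gt0 : (0 < n)%N. Proof. exact: ltnW. Qed.
Local Notation e := (@ising R n).
Local Notation U l := (uu e n l : cmx R (2 ^ n)).
Local Notation V l := (vv e n l : cmx R (2 ^ n)).
Local Notation W l := (ww e n l : cmx R (2 ^ n)).

Let e_per := @ising_per R n.
Let e_sq := @ising_sqr R n.
Let e_same := @ising_same R n.
Let e_anti := @ising_anti R n n_gt1.
Let e_far := @ising_far R n n_gt1.

Let W_same a : odd a = false -> comm (ww e n 0) (e a) = 0.
Proof. exact: (@comm_sum_same _ _ _ n_gt1 e_per e_same false). Qed.
Let W_near a : odd a = false ->
  comm (ww e n 0) (e a.+1) = (e a * e a.+1 - e a.+1 * e a.+2) *+ 2.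
Proof. exact: (@comm_sum_near _ _ _ n_gt1 e_per e_anti e_far false). Qed.
Let U_same a : odd a = true -> comm (uu e n 0) (e a) = 0.
Proof. exact: (@comm_sum_same _ _ _ n_gt1 e_per e_same true). Qed.
Let U_near a : odd a = true ->
  comm (uu e n 0) (e a.+1) = (e a * e a.+1 - e a.+1 * e a.+2) *+ 2.
Proof. exact: (@comm_sum_near _ _ _ n_gt1 e_per e_anti e_far true). Qed.

Let WU l : lie_bracket (W 0) (U l) = V l.+1 *+ 2.
Proof. exact: comm_ww_uu. Qed.
Let WV l : lie_bracket (W 0) (V l.+1) = - (U l + W l.+1) *+ 4.
Proof. exact: comm_ww_vv. Qed.
Let WW l : lie_bracket (W 0) (W l.+1) = V l.+1 *+ 2.
Proof. exact: comm_ww_ww. Qed.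
Let WW0 : lie_bracket (W 0) (W 0) = 0.
Proof. exact: comm_ww_ww0. Qed.
Let UU0 : lie_bracket (U 0) (U 0) = 0.
Proof. exact: comm_uu_uu0. Qed.
Let UU l : lie_bracket (U 0) (U l.+1) = - V l.+1 *+ 2.
Proof. exact: comm_uu_uu. Qed.
Let UW l : lie_bracket (U 0) (W l) = - V l.+1 *+ 2.
Proof. exact: comm_uu_ww. Qed.
Let UV l : lie_bracket (U 0) (V l.+1) = (U l.+1 + W l) *+ 4.
Proof. exact: comm_uu_vv. Qed.

Let XE : opX R n = - W 0. Proof. exact: opXE. Qed.
Let Xn1E : opXn1 R n = - U n.-1. Proof. exact: opXn1E. Qed.
Let ZXZE t : opZXZ R n t = - U t. Proof. exact: opZXZE. Qed.
Let YXYE t : opYXY R n t = W t.+1. Proof. exact: opYXYE. Qed.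
Let YXZE t : opYXZ R n t = V t.+1. Proof. exact: opYXZE. Qed.
Let ZZE : ('i%C *: (\sum_(j < n)
    (on_qubit n (pauliZ R) j *m on_qubit n (pauliZ R) j.+1)) : cmx R (2 ^ n)) = - U 0.
Proof. exact: generator_ZZE. Qed.

Lemma opX_opXn1_comm : lie_bracket (opX R n) (opXn1 R n) = 0.
Proof.
apply: comm_scale; apply: commr_sum => j _; apply/commr_sym.
apply: commr_sum => k _; apply/commr_sym; apply: commr_prod => l _.
exact: on_qubit_comm.
Qed.

(** The chain of brackets stops here: [V n] is half the bracket of [W 0] with [U n.-1], and these
    are, up to sign, [opX] and [opXn1], which commute because they contain only [X] factors. *)
Lemma vv_n : V n = 0.
Proof.
have := WU n.-1; rewrite prednK // => E.
suff: V n *+ 2 \in 0%VS by move/memv_mulrn; rewrite memv0 => /eqP.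
rewrite -E memv0; apply/eqP; rewrite -[RHS]opX_opXn1_comm XE Xn1E.
by rewrite /lie_bracket !mulNmx !mulmxN !opprK.
Qed.

Local Notation B := (<<dla_basis R n>>%VS).

Lemma mem_dla_basis (Q : cmx R (2 ^ n) -> Prop) :
  Q (opX R n) -> Q (opXn1 R n) ->
  (forall t, (t.+1 < n)%N -> Q (opZXZ R n t)) ->
  (forall t, (t.+1 < n)%N -> Q (opYXY R n t)) ->
  (forall t, (t.+1 < n)%N -> Q (opYXZ R n t)) ->
  forall A, A \in dla_basis R n -> Q A.
Proof.
move=> Q1 Q2 Q3 Q4 Q5 A; rewrite /dla_basis !mem_cat !inE.
have inT t : t \in iota 0 n.-1 -> (t.+1 < n)%N by rewrite mem_iota; lia.
by case/orP=> [/orP[]/eqP->//|/or3P[]/mapP[t /inT tn ->]]; auto.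
Qed.

Let inT t : (t.+1 < n)%N -> t \in iota 0 n.-1.
Proof. by rewrite mem_iota; lia. Qed.

Lemma ZXZ_in_span t : (t.+1 < n)%N -> opZXZ R n t \in B.
Proof.
move=> /inT tn; apply: memv_span; rewrite /dla_basis !mem_cat.
by apply/orP; right; apply/orP; left; apply: map_f.
Qed.

Lemma YXY_in_span t : (t.+1 < n)%N -> opYXY R n t \in B.
Proof.
move=> /inT tn; apply: memv_span; rewrite /dla_basis !mem_cat.
by apply/or4P; apply: Or43; apply: map_f.
Qed.

Lemma YXZ_in_span t : (t.+1 < n)%N -> opYXZ R n t \in B.
Proof.
move=> /inT tn; apply: memv_span; rewrite /dla_basis !mem_cat.
by apply/or4P; apply: Or44; apply: map_f.
Qed.

Lemma uu_in_span l : (l < n)%N -> U l \in B.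
Proof.
move=> ln; rewrite -memvN; case: (ltnP l.+1 n) => [l1n|nl].
  by rewrite -ZXZE ZXZ_in_span.
(* The top index is outside the range of the [opZXZ] family and is supplied by [opXn1]. *)
have -> : l = n.-1 by lia.
by rewrite -Xn1E memv_span // /dla_basis !inE eqxx orbT.
Qed.

Lemma ww_in_span l : (l < n)%N -> W l \in B.
Proof.
case: l => [_|l ln]; last by rewrite -YXYE YXY_in_span.
by rewrite -memvN -XE memv_span // /dla_basis !inE eqxx.
Qed.

Lemma vv_in_span l : (l <= n)%N -> V l \in B.
Proof.
case: l => [_|l]; first by rewrite vv0 mem0v.
rewrite leq_eqVlt => /predU1P[->|ln]; first by rewrite vv_n mem0v.
by rewrite -YXZE YXZ_in_span.
Qed.

(** The Lie algebra generators are [- W 0] and [- U 0], whence [- D], while the bracket relations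
    are stated for [D] itself. *)
Lemma memv_span_stable (D : cmx R (2 ^ n)) :
  (forall l, (l < n)%N -> lie_bracket D (U l) \in B) ->
  (forall l, (l < n)%N -> lie_bracket D (W l) \in B) ->
  (forall l, (l.+1 < n)%N -> lie_bracket D (V l.+1) \in B) ->
  forall A, A \in B -> lie_bracket (- D) A \in B.
Proof.
move=> DU DW DV A AB.
have -> : lie_bracket (- D) A = - lie_bracket D A.
  by rewrite -[- D]addr0 -scaleN1r lie_bracketDl lie_bracket0 addr0 scaleN1r.
rewrite memvN; move: AB.
apply: (span_ind (Q := fun A => lie_bracket D A \in B)) => [|a u v uB vB|].
- by rewrite lie_bracket_r0 mem0v.
- by rewrite lie_bracketDr memvD ?memvZ.
have DN u : lie_bracket D u \in B -> lie_bracket D (- u) \in B.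
  by move=> h; rewrite -[- u]addr0 -scaleN1r lie_bracketDr lie_bracket_r0
    addr0 memvZ.
apply: mem_dla_basis => [||t tn|t tn|t tn].
- by rewrite XE; apply/DN/DW.
- by rewrite Xn1E; apply/DN/DU; lia.
- by rewrite ZXZE; apply/DN/DU; lia.
- by rewrite YXYE; apply/DW.
by rewrite YXZE; apply/DV.
Qed.

(** Brackets of a generator with [U l] or [W l], [l < n], are multiples of some [V m] with [m <= n]
    or zero, and [vv_n] covers [m = n]. Brackets with [V l.+1], [l.+1 < n], involve only [U] and [W]
    at the indices [l] and [l.+1]. *)
Lemma dla_sub_span : (dla_cycle R n <= B)%VS.
Proof.
rewrite /dla_cycle XE ZZE; apply: lie_gen_stable => [A|A C].
  by rewrite !inE => /orP[]/eqP->; rewrite memvN ?ww_in_span ?uu_in_span.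
rewrite !inE => /orP[]/eqP->; apply: memv_span_stable => {A C} [l ln|[|l] ln|l ln].
- by rewrite WU rpredMn ?vv_in_span.
- by rewrite WW0 mem0v.
- by rewrite WW rpredMn ?vv_in_span // ltnW.
- by rewrite WV rpredMn // memvN memvD ?uu_in_span ?ww_in_span // ltnW.
- case: l ln => [|l] ln; first by rewrite UU0 mem0v.
  by rewrite UU rpredMn // memvN vv_in_span // ltnW.
- by rewrite UW rpredMn // memvN vv_in_span.
- by rewrite UW rpredMn // memvN vv_in_span.
by rewrite UV rpredMn // memvD ?uu_in_span ?ww_in_span // ltnW.
Qed.

Lemma span_sub_dla : (B <= dla_cycle R n)%VS.
Proof.
set g := dla_cycle R n.
have gX : W 0 \in g.
  by rewrite -memvN -XE; apply: lie_gen_sub; rewrite !inE eqxx.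
have gZ : U 0 \in g.
  by rewrite -memvN -ZZE; apply: lie_gen_sub; rewrite !inE eqxx orbT.
have gbr A C : A \in g -> C \in g -> lie_bracket A C \in g.
  exact: lie_gen_closed.
have gV l : U l \in g -> V l.+1 \in g.
  by move=> gU; apply: (@memv_mulrn _ _ _ _ 1); rewrite -WU gbr.
(* From [U l] one gets [V l.+1]. Its brackets with [U 0] and [W 0] are multiples of [U l.+1 + W l]
   and [U l + W l.+1], and subtracting the known summand leaves the next pair. *)
have gUW l : U l \in g /\ W l \in g.
  elim: l => [|l [gU gW]]; first by [].
  have gVl := gV l gU; split.
    have := gbr _ _ gZ gVl; rewrite UV => /memv_mulrn h.
    by rewrite -[U _](addrK (W l)) memvB.
  have := gbr _ _ gX gVl; rewrite WV => /memv_mulrn; rewrite memvN => h.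
  by rewrite -[W _](addKr (U l)) memvD ?memvN.
apply/span_subvP; apply: mem_dla_basis => [||t _|t _|t _].
- by rewrite XE memvN.
- by rewrite Xn1E memvN; case: (gUW n.-1).
- by rewrite ZXZE memvN; case: (gUW t).
- by rewrite YXYE; case: (gUW t.+1).
by rewrite YXZE; apply: gV; case: (gUW t).
Qed.

End Main.

Theorem theorem15 (R : realType) (n : nat) (hn : (3 <= n)%N) :
  \dim (dla_cycle R n) = (3 * n - 1)%N /\
  basis_of (dla_cycle R n) (dla_basis R n).
Proof.
have basisP : basis_of (dla_cycle R n) (dla_basis R n).
  rewrite /basis_of free_dla_basis // andbT eqEsubv.
  by rewrite span_sub_dla ?dla_sub_span.
(* The dimension is the length of the list, [2 + 3 * (n - 1)]. *)
split=> //; rewrite (size_basis (X := in_tuple (dla_basis R n)) basisP).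
by rewrite /dla_basis !size_cat !size_map size_iota /=; lia.
Qed.
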